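(* Let $\epsilon_0=\epsilon_0(m)>0$ be the dimensional constant described in the context. Suppose $\{(X^m,g(t)),\ -\infty<t\le 0\}$ is a non-flat, ancient Ricci flow solution on a complete manifold $X^m$ such that $$\limsup_{t\to-\infty}Q(t)|t|<\infty .$$ Then $$\limsup_{t\to-\infty}P(t)|t|\ \ge\ \frac{\epsilon_0}{\log 2}.$$
   Context: A Ricci flow solution is a smooth family of complete Riemannian metrics $g(t)$ on $X$ ($m=\dim_{\mathbb R}X$) satisfying $\frac{\partial}{\partial t}g=-2\,Ric$. Notation: $P(t)=\sup_X|Ric|_{g(t)}$ and $Q(t)=\sup_X|Rm|_{g(t)}$, norms taken with respect to $g(t)$. The constant $\epsilon_0=\epsilon_0(m)>0$ depends only on $m$ and has the following property (its existence is an earlier theorem of the paper): whenever $K\ge 0$ and $\{(X^m,g(t)),\ -\frac18\le t\le K\}$ is a Ricci flow solution on a complete manifold $X^m$ with $Q(0)=1$ and $Q(t)\le 2$ for all $t\in[-\frac18,0]$, then: if $T$ is the first time in $[0,K]$ with $Q(T)=2$, there exist $x\in X$ and a nonzero $V\in T_xX$ with $\left|\log\frac{\langle V,V\rangle_{g(0)}}{\langle V,V\rangle_{g(T)}}\right|>\epsilon_0$, and $\int_0^TP(t)\,dt>\epsilon_0$; and (whether or not such a $T$ exists) $Q(K)<2^{\frac{1}{\epsilon_0}\int_0^KP(t)\,dt+1}$. *)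

(* Defs.v *)
From HB Require Import structures.
From mathcomp Require Import all_boot all_order all_algebra.
From mathcomp Require Import all_classical all_reals all_analysis.

Set Implicit Arguments.
Unset Strict Implicit.
Unset Printing Implicit Defensive.

Import Order.TTheory GRing.Theory Num.Theory.
Import numFieldNormedType.Exports.

Local Open Scope classical_set_scope.
Local Open Scope ring_scope.

(** * Smooth maps *)

(* [f] is of class C^k on the open set [O]: all iterated directional
   derivatives of order at most [k] exist and are continuous on [O]. *)
Fixpoint class_C {R : realType} {V W : normedModType R}
    (k : nat) (O : set V) (f : V -> W) : Prop :=
  {in O, continuous f} /\
  match k with
  | 0%N => True
  | k'.+1 => forall v : V,
      (forall x, O x -> derivable f x v) /\ class_C k' O ('D_v f)
  end.

Definition smooth_open {R : realType} {V W : normedModType R}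
    (O : set V) (f : V -> W) : Prop :=
  forall k, class_C k O f.

(* On an arbitrary subset, smoothness means local smooth extendability; this is
   what is meant at the closed ends of a time interval. *)
Definition smooth_on {R : realType} {V W : normedModType R}
    (A : set V) (f : V -> W) : Prop :=
  forall p, A p -> exists (O : set V) (h : V -> W),
    [/\ open O, O p, smooth_open O h & forall q, O q -> A q -> f q = h q].

(** * Smooth manifolds *)

Record chart (R : realType) (m : nat) (T : topologicalType) := Chart {
  cdom : set T ;
  ccod : set 'rV[R]_m ;
  cmap : T -> 'rV[R]_m ;
  cinv : 'rV[R]_m -> T ;
  cdom_open : open cdom ;
  ccod_open : open ccod ;
  cmap_ccod : forall x, cdom x -> ccod (cmap x) ;
  cinv_cdom : forall u, ccod u -> cdom (cinv u) ;
  cmapK : forall x, cdom x -> cinv (cmap x) = x ;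
  cinvK : forall u, ccod u -> cmap (cinv u) = u ;
  cmap_continuous : {in cdom, continuous cmap} ;
  cinv_continuous : {in ccod, continuous cinv} }.

(* The coordinates of the points of the domain of [a] also in that of [b],
   and the change of coordinates from [a] to [b]. *)
Definition overlap (R : realType) (m : nat) (T : topologicalType)
    (a b : chart R m T) : set 'rV[R]_m :=
  [set u | ccod a u /\ cdom b (cinv a u)].

Definition transition (R : realType) (m : nat) (T : topologicalType)
    (a b : chart R m T) (u : 'rV[R]_m) : 'rV[R]_m := cmap b (cinv a u).

Record manifold (R : realType) (m : nat) := Manifold {
  pt :> topologicalType ;
  pt_hausdorff : hausdorff_space pt ;
  pt_second_countable : @second_countable pt ;
  ix : Type ;
  atlas : ix -> chart R m pt ;
  atlas_cover : forall x : pt, exists i, cdom (atlas i) x ;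
  atlas_smooth : forall i j,
    smooth_open (overlap (atlas i) (atlas j))
                (transition (atlas i) (atlas j)) }.

(** * Riemannian metrics and their curvature *)

(* A (0,2)-tensor field: [G i u] is its matrix of components, in the chart
   [atlas i], at the point with coordinates [u]. *)
Definition field (R : realType) (m : nat) (M : manifold R m) :=
  ix M -> 'rV[R]_m -> 'M[R]_m.

Section Geometry.
Context {R : realType} {m : nat} {M : manifold R m}.
Implicit Types (G : field M) (i : ix M) (u : 'rV[R]_m) (x y z : M).

Definition inner (A : 'M[R]_m) (v w : 'rV[R]_m) : R := (v *m A *m w^T) 0 0.

(* Vectors are rows, so a tangent vector with components [v] in chart [i] has
   components [v *m jacobian (transition _ _) u] in chart [j]. *)
Definition riemannian_metric G : Prop :=
  [/\ forall i (a b : 'I_m),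
        smooth_open (ccod (atlas i)) (fun u => G i u a b : R^o),
      forall i u, ccod (atlas i) u -> (G i u)^T = G i u,
      forall i u, ccod (atlas i) u ->
        forall v, v != 0 -> 0 < inner (G i u) v v
    & forall i j u, overlap (atlas i) (atlas j) u ->
        let J := jacobian (transition (atlas i) (atlas j)) u in
        G i u = J *m G j (transition (atlas i) (atlas j) u) *m J^T].

(* A C^1 curve, parametrized by [0, 1], inside one coordinate domain. *)
Definition curve_in i (c : R -> 'rV[R]_m) : Prop :=
  [/\ forall s : R, derivable c s 1,
      continuous (derive1 c)
    & forall s, 0 <= s <= 1 -> ccod (atlas i) (c s)].

Definition curve_length G i (c : R -> 'rV[R]_m) : R :=
  \int[lebesgue_measure]_(s in `[0, 1])
     Num.sqrt (inner (G i (c s)) (derive1 c s) (derive1 c s)).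

(* [joined G x y L]: a piecewise C^1 curve of length [L] goes from [x] to [y].
   Every such curve has a subdivision with pieces in coordinate domains. *)
Inductive joined G : M -> M -> R -> Prop :=
| joined_refl x : joined G x x 0
| joined_step i (c : R -> 'rV[R]_m) y L :
    curve_in i c -> joined G (cinv (atlas i) (c 1)) y L ->
    joined G (cinv (atlas i) (c 0)) y (curve_length G i c + L).

(* Equal to +oo when [x] and [y] lie in different components: manifolds are not
   required to be connected. *)
Definition riem_dist G x y : \bar R :=
  ereal_inf [set L%:E | L in joined G x y].

Definition complete_metric G : Prop :=
  forall s : nat -> M,
    (forall e : R, 0 < e -> exists N, forall k l, (N <= k)%N -> (N <= l)%N ->
      (riem_dist G (s k) (s l) < e%:E)%E) ->
    exists x, forall e : R, 0 < e -> exists N, forall k, (N <= k)%N ->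
      (riem_dist G (s k) x < e%:E)%E.

Definition partial (a : 'I_m) (f : 'rV[R]_m -> R) (u : 'rV[R]_m) : R :=
  'D_(delta_mx 0 a) (f : 'rV[R]_m -> R^o) u.

(* [christoffel G i a b c] is Gamma^c_ab. *)
Definition christoffel G i (a b c : 'I_m) u : R :=
  2^-1 * \sum_d invmx (G i u) c d *
    (partial a (fun w => G i w b d) u + partial b (fun w => G i w a d) u
     - partial d (fun w => G i w a b) u).

(* [riemann G i a b c d] is the component R_abc^d of
   R(d_a, d_b) d_c = nabla_a nabla_b d_c - nabla_b nabla_a d_c. *)
Definition riemann G i (a b c d : 'I_m) u : R :=
  partial a (christoffel G i b c d) u - partial b (christoffel G i a c d) u
  + \sum_e (christoffel G i b c e u * christoffel G i a e d u
            - christoffel G i a c e u * christoffel G i b e d u).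

(* The trace of X |-> R(X, d_b) d_c, positive on round spheres. *)
Definition ricci G : field M :=
  fun i u => \matrix_(b, c) \sum_a riemann G i a b c a u.

Definition ricci_norm G i u : R :=
  let g' := invmx (G i u) in
  Num.sqrt (\sum_a \sum_b \sum_a' \sum_b'
    g' a a' * g' b b' * ricci G i u a b * ricci G i u a' b').

Definition riemann_norm G i u : R :=
  let g := G i u in let g' := invmx g in
  Num.sqrt (\sum_a \sum_b \sum_c \sum_d \sum_a' \sum_b' \sum_c' \sum_d'
    g' a a' * g' b b' * g' c c' * g d d' *
    riemann G i a b c d u * riemann G i a' b' c' d' u).

(* [ricci_norm] and [riemann_norm] depend only on the point, not on the chart,
   so these are the suprema over the points of the manifold. *)
Definition sup_ricci G : \bar R :=
  ereal_sup [set r : \bar R | exists i u,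
    ccod (atlas i) u /\ r = (ricci_norm G i u)%:E].

Definition sup_riemann G : \bar R :=
  ereal_sup [set r : \bar R | exists i u,
    ccod (atlas i) u /\ r = (riemann_norm G i u)%:E].

Definition flat G : Prop :=
  forall i u, ccod (atlas i) u -> forall a b c d, riemann G i a b c d u = 0.

(** * Ricci flow *)

(* The time derivative is taken within [I], so it is one-sided at the ends. *)
Definition ricci_flow (I : set R) (g : R -> field M) : Prop :=
  [/\ forall t, I t -> riemannian_metric (g t) /\ complete_metric (g t),
      forall i (a b : 'I_m),
        smooth_on [set p : R^o * 'rV[R]_m | I p.1 /\ ccod (atlas i) p.2]
                  (fun p => g p.1 i p.2 a b : R^o)
    & forall t i u, I t -> ccod (atlas i) u ->
        (s - t)^-1 *: (g s i u - g t i u) @[s --> within I t^']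
          --> (- 2) *: ricci (g t) i u].

Definition curvP (g : R -> field M) (t : R) : \bar R := sup_ricci (g t).
Definition curvQ (g : R -> field M) (t : R) : \bar R := sup_riemann (g t).

(* "Non-flat" for an ancient solution: it is not identically flat on any ray
   (-oo, t].  This holds if every g(t) is non-flat.  When curvature is bounded
   on compact time intervals it also holds as soon as some g(t) is non-flat,
   because a flat flow then stays flat; no such bound is assumed here. *)
Definition non_flat_ancient (g : R -> field M) : Prop :=
  forall t, t <= 0 -> exists2 s, s <= t & ~ flat (g s).

End Geometry.

(* The defining property of epsilon_0(m).  It speaks of the real numbers Q(t)
   and P(t), so it is asked of flows with bounded curvature on the compact time
   interval only; complete flows whose curvature is bounded at first and
   unbounded later exist.  The exponential [expeR] with the factor [ln 2] gives
   the power of 2 with an extended real exponent. *)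
Definition epsilon0_property (R : realType) (m : nat) (eps : R) : Prop :=
  0 < eps /\
  forall (M : manifold R m) (g : R -> field M) (K : R),
    0 <= K ->
    ricci_flow `[- 8^-1, K] g ->
    (exists C : R, forall t, - 8^-1 <= t <= K -> (curvQ g t <= C%:E)%E) ->
    curvQ g 0 = 1%E ->
    (forall t, - 8^-1 <= t <= 0 -> (curvQ g t <= 2%:E)%E) ->
    (forall T : R,
       0 <= T <= K -> curvQ g T = 2%:E ->
       (forall s, 0 <= s < T -> curvQ g s <> 2%:E) ->
       (exists (i : ix M) (u v : 'rV[R]_m),
          [/\ ccod (atlas i) u, v != 0 &
              eps < `| ln (inner (g 0 i u) v v / inner (g T i u) v v) |]) /\
       (eps%:E < \int[lebesgue_measure]_(t in `[0%R, T]) curvP g t)%E) /\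
    (curvQ g K < expeR ((ln 2)%:E *
       ((eps^-1)%:E * \int[lebesgue_measure]_(t in `[0%R, K]) curvP g t + 1)))%E.

(* Main.v *)
Require Import Defs.
From HB Require Import structures.
From mathcomp Require Import all_boot all_order all_algebra.
From mathcomp Require Import all_classical all_reals all_analysis.
From mathcomp Require Import ring lra.

Set Implicit Arguments.
Unset Strict Implicit.
Unset Printing Implicit Defensive.

Import Order.TTheory GRing.Theory Num.Theory.
Import numFieldNormedType.Exports.

Local Open Scope classical_set_scope.
Local Open Scope ring_scope.

(** Suppose the limsup of P(t)|t| were smaller than eps0 / ln 2.  Then
    P(x) <= A/|x| for all very negative x, with a := A ln 2 / eps0 < 1, and
    Q(x) <= C/|x| there by the type I bound.  Fix such a time t with Q(t) > 0.

    For a very negative time s that is good, meaning that Q(x) <= 2 Q(s) for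
    x <= s, put q := Q(s).  The flow tau |-> q g(s + tau/q) is again a Ricci
    flow, has curvature norm 1 at time 0 and at most 2 before, so the defining
    property of eps0 applies to it on [-1/8, q (t - s)].  As P scales like 1/q,
    the integral of its Ricci norm is at most
    \int_s^t A/|x| dx = A ln(s/t), and the property gives
    [curvature_growth]:  Q(t) < 2 q (s/t)^a <= 2 (C/|s|) (s/t)^a.
    Since a < 1 the right-hand side tends to 0 as s goes to -oo, which
    contradicts Q(t) > 0.

    Good times exist arbitrarily far in the past: for s0 very negative, Q is
    bounded on (-oo, s0] and positive somewhere there, and any s at which it
    exceeds half of its supremum over this ray will do [exists_half_sup].

    That Q is positive when the metric is not flat
    [sup_riemann_gt0] needs the positivity of the squared norm of a 4-tensor;
    it follows from a Cholesky factorization of the metric, as tensor products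
    of Gram kernels are Gram kernels [gram_tensor].  That parabolic rescaling
    preserves Ricci flows [ricci_flow_rescale] includes the smoothness and the
    completeness of the rescaled metrics. *)

(** * Integrals of functions not known to be measurable *)

Section Integral.
Context d (T : measurableType d) (R : realType) (mu : {measure set T -> \bar R}).
Local Open Scope ereal_scope.
Import HBNNSimple.

(** The integral of a nonnegative function is by definition the supremum of
    the integrals of the simple functions below it, so monotonicity does not
    depend on measurability.  The Ricci supremum, as a function of time, is not
    known to be measurable. *)
Lemma ge0_le_lower_integral (D : set T) (f1 f2 : T -> \bar R) :
  (forall x, D x -> 0 <= f1 x) -> (forall x, D x -> f1 x <= f2 x) ->
  \int[mu]_(x in D) f1 x <= \int[mu]_(x in D) f2 x.
Proof.
move=> f10 f12.
have f20 x : D x -> 0 <= f2 x by move=> Dx; apply: le_trans (f12 _ Dx); exact: f10.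
rewrite !ge0_integralE//; apply: le_ereal_sup => _ [h /= hf <-].
exists h => //= x; apply: le_trans (hf x) _.
by rewrite /patch; case: ifPn => // /set_mem; exact: f12.
Qed.

(** Scaling the simple functions gives one inequality for k and, applied to
    k^-1, the other. *)
Lemma ge0_lower_integralZl (D : set T) (f : T -> \bar R) (k : R) :
  (0 < k)%R -> (forall x, D x -> 0 <= f x) ->
  \int[mu]_(x in D) (k%:E * f x) = k%:E * \int[mu]_(x in D) f x.
Proof.
have half (k' : R) (f' : T -> \bar R) :
    (0 < k')%R -> (forall x, D x -> 0 <= f' x) ->
    k'%:E * \int[mu]_(x in D) f' x <= \int[mu]_(x in D) (k'%:E * f' x).
  move=> k0 f0.
  have kf0 x : D x -> 0 <= k'%:E * f' x.
    by move=> Dx; rewrite mule_ge0 ?f0// lee_fin ltW.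
  rewrite muleC -lee_pdivlMr// ge0_integralE//.
  apply: ge_ereal_sup => _ [h /= hf <-].
  rewrite lee_pdivlMr// muleC -sintegralrM ge0_integralE//.
  apply: ereal_sup_ubound; exists (scale_nnsfun h (ltW k0)) => //= x.
  have := hf x; rewrite /patch; case: ifPn => _ hfx; rewrite EFinM.
    by rewrite lee_pmul2l// lte_fin.
  by rewrite mule_ge0_le0// lee_fin ltW.
move=> k0 f0; apply/eqP; rewrite eq_le half// andbT.
have kf0 x : D x -> 0 <= k%:E * f x.
  by move=> Dx; rewrite mule_ge0 ?f0// lee_fin ltW.
have := half k^-1%R (fun x => k%:E * f x); rewrite invr_gt0 => /(_ k0 kf0).
under [in X in _ <= X -> _]eq_integral => x _.
  rewrite muleA -EFinM mulVf ?gt_eqF// mul1e; over.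
by rewrite muleC lee_pdivrMr// muleC.
Qed.

End Integral.

(** * Affine changes of variables in smooth functions *)

Section Smooth.
Context {R : realType}.

(** The difference quotients of c *: f \o phi along v are c times those of f
    along L v, so directional derivatives of the composite have the same form
    and the induction goes through.  F is compared with the composite only on
    the preimage of O, since derivatives scale only where they exist. *)
Lemma class_C_affine (V V' W : normedModType R) (phi L : V' -> V) (c : R) :
  continuous phi -> (forall p h v, phi (h *: v + p) = h *: L v + phi p) ->
  forall (O : set V) (k : nat) (f : V -> W) (F : V' -> W), open O ->
  (forall p, O (phi p) -> F p = c *: f (phi p)) ->
  class_C k O f -> class_C k (phi @^-1` O) F.
Proof.
move=> phi_cont phi_aff O k f F oO.
have oO' : open (phi @^-1` O) by move/continuousP: phi_cont; exact.
have near_O f' F' p : (forall p, O (phi p) -> F' p = c *: f' (phi p)) ->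
    O (phi p) -> \near p, F' p = c *: f' (phi p) :> W.
  by move=> Ff Op; apply: filterS (open_nbhs_nbhs (conj oO' Op)) => q; exact: Ff.
have Fcont f' F' : (forall p, O (phi p) -> F' p = c *: f' (phi p) :> W) ->
    {in O, continuous f'} -> {in phi @^-1` O, continuous F'}.
  move=> Ff fcont p /set_mem Op; rewrite /continuous_at (Ff _ Op).
  have e : \near p, c *: f' (phi p) = F' p.
    by apply: filterS (near_O _ _ _ Ff Op) => q ->.
  apply: cvg_trans (near_eq_cvg e) _.
  apply: cvgZr; apply: (cvg_comp _ _ (phi_cont p)); apply: fcont; exact/mem_set.
elim: k f F => [|k IH] f F Ff /=; first by move=> [/(Fcont _ _ Ff)].
move=> [/(Fcont _ _ Ff) cF df]; split=> // v.
have dphi p : derivable f (phi p) (L v) ->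
    derivable (f \o phi) p v /\ 'D_v (f \o phi) p = 'D_(L v) f (phi p).
  rewrite /derivable /derive.
  suff -> : (fun h => h^-1 *: (((f \o phi) \o shift p) (h *: v) - (f \o phi) p))
      = (fun h => h^-1 *: ((f \o shift (phi p)) (h *: L v) - f (phi p))) by [].
  by apply/funext => h /=; rewrite phi_aff.
have dF p : O (phi p) -> derivable F p v /\ 'D_v F p = c *: 'D_(L v) f (phi p).
  move=> Op; have [d1 D1] := dphi _ ((df (L v)).1 _ Op).
  have e := near_O _ _ _ Ff Op.
  have e' : {near p, (c \*: (f \o phi) : V' -> W) =1 F}.
    by apply: filterS e => q ->.
  split; first exact: near_eq_derivable e' (derivableZ d1).
  by rewrite -(near_eq_derive _ e') deriveZ// D1.
split; first by move=> p /dF[].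
by apply: (IH ('D_(L v) f)) (df (L v)).2 => p /dF[].
Qed.

End Smooth.

(** * Positive definite matrices and Gram kernels *)

Section Gram.
Context {R : realType}.

Lemma innerE m (A : 'M[R]_m) (v : 'rV_m) :
  inner A v v = \sum_a \sum_b A a b * v 0 a * v 0 b.
Proof.
rewrite /inner mxE exchange_big /=; apply: eq_bigr => b _; rewrite !mxE mulr_suml.
by apply: eq_bigr => a _; rewrite [v 0 a * _]mulrC.
Qed.

(** Induction on the size: the Schur complement of the top left entry is again
    positive definite. *)
Lemma cholesky n (A : 'M[R]_n) : A^T = A ->
  (forall v : 'rV_n, v != 0 -> 0 < inner A v v) ->
  exists2 L, L \in unitmx & A = L *m L^T.
Proof.
elim: n A => [|n IH] A symA posA.
  by exists 1%:M; [exact: unitmx1 | rewrite [LHS]flatmx0 [RHS]flatmx0].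
pose A' := A : 'M[R]_(1 + n); have symA' : A'^T = A' by [].
pose a := A 0 0; pose r := ursubmx A'; pose D : 'M[R]_n := drsubmx A'.
have ulA : ulsubmx A' = a%:M.
  by rewrite [LHS]mx11_scalar !mxE; congr (A _ _)%:M; apply/val_inj.
have dlA : dlsubmx A' = r^T by rewrite /r trmx_ursub symA'.
have symD : D^T = D by rewrite /D trmx_drsub symA'.
have AE : A' = block_mx a%:M r r^T D by rewrite -ulA -dlA submxK.
have a_gt0 : 0 < a.
  have := posA (delta_mx 0 0); rewrite innerE => /(_ _).
  rewrite (bigD1 0)//= (bigD1 0)//= !mxE /= !mulr1 !big1 ?addr0; first last.
  - by move=> i i0; rewrite mxE (negPf i0) mulr0.
  - by move=> i i0; rewrite big1// => b _; rewrite mxE (negPf i0) mulr0 mul0r.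
  apply; apply/eqP => /rowP/(_ 0); rewrite !mxE /= => /eqP.
  by rewrite oner_eq0.
have [] := IH (D - a^-1 *: (r^T *m r)).
- by rewrite linearB linearZ /= trmx_mul trmxK symD.
- move=> w w0; pose c : 'M[R]_1 := - a^-1 *: (w *m r^T).
  (* c completes the square: the form of A at v is that of
     the Schur complement at w. *)
  pose v : 'rV_(1 + n) := row_mx c w.
  have : 0 < inner (A' : 'M[R]_(1 + n)) v v.
    by apply: posA; apply: contra_neq w0 => v0; rewrite -[w](row_mxKr c) -/v v0 linear0.
  rewrite /inner AE /v tr_row_mx mul_row_block mul_row_col.
  have -> : c *m a%:M + w *m r^T = 0.
    by rewrite mul_mx_scalar /c scalerA mulrN divff ?gt_eqF// scaleN1r addNr.
  rewrite mul0mx add0r /c mulmxBr -scalemxAr mulmxA -scalemxAl scaleNr.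
  by rewrite addrC.
move=> L unitL SE; set s := Num.sqrt a.
have s_neq0 : s != 0 by rewrite gt_eqF// sqrtr_gt0.
have ssq : s * s = a by rewrite -expr2 sqr_sqrtr// ltW.
exists (block_mx s%:M 0 (s^-1 *: r^T) L : 'M[R]_(1 + n)).
  rewrite unitmxE (det_lblock (s%:M : 'M[R]_1)) unitrM -!unitmxE unitL andbT.
  by rewrite unitmxE det_scalar1 unitfE.
rewrite -[LHS]/A' AE [in RHS](tr_block_mx (s%:M : 'M[R]_1)).
apply: etrans; last by apply/esym; exact: (@mulmx_block _ 1 n 1 n 1 n).
rewrite tr_scalar_mx trmx0 linearZ /= trmxK !mulmx0 !mul0mx !addr0 -SE.
f_equal.
- by rewrite mul_scalar_mx scale_scalar_mx ssq.
- by rewrite mul_scalar_mx scalerA divff// scale1r.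
- by rewrite mul_mx_scalar scalerA divff// scale1r.
- by rewrite -scalemxAl -scalemxAr scalerA -invfM ssq addrCA subrr addr0.
Qed.

(** Positive definiteness in factored form, K = B^T B with B injective.  Unlike
    the inequality, this passes directly to tensor products. *)
Definition gram (I : finType) (K : I -> I -> R) :=
  exists (J : finType) (B : J -> I -> R),
    (forall i i', K i i' = \sum_k B k i * B k i') /\
    (forall v : I -> R, (forall k, \sum_i B k i * v i = 0) -> forall i, v i = 0).

Lemma gram_gt0 (I : finType) (K : I -> I -> R) (v : I -> R) (i0 : I) :
  gram K -> v i0 != 0 -> 0 < \sum_i \sum_j K i j * v i * v j.
Proof.
move=> [J [B [KE Binj]]] v0.
have -> : \sum_i \sum_j K i j * v i * v j = \sum_k (\sum_i B k i * v i) ^+ 2.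
  transitivity (\sum_k \sum_i \sum_j B k i * v i * (B k j * v j)); last first.
    apply: eq_bigr => k _; rewrite expr2 mulr_suml.
    by apply: eq_bigr => i _; rewrite mulr_sumr.
  rewrite [RHS]exchange_big; apply: eq_bigr => i _ /=.
  rewrite [RHS]exchange_big; apply: eq_bigr => j _ /=.
  rewrite KE !mulr_suml; by apply: eq_bigr => k _; rewrite -mulrA mulrACA.
rewrite lt_neqAle sumr_ge0 ?andbT; last by move=> k _; exact: sqr_ge0.
apply: contra_neq v0 => /esym/eqP; rewrite psumr_eq0; last by move=> k _; exact: sqr_ge0.
move=> /allP s0; apply: Binj => k; apply/eqP.
by have := s0 k (mem_index_enum _); rewrite sqrf_eq0.
Qed.

(** The factors multiply, and injectivity of the product is checked one index
    at a time. *)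
Lemma gram_tensor (I I' : finType) (K : I -> I -> R) (K' : I' -> I' -> R) :
  gram K -> gram K' ->
  gram (fun p q : I * I' => K p.1 q.1 * K' p.2 q.2).
Proof.
move=> [J [B [KE Binj]]] [J' [B' [KE' Binj']]].
exists (J * J')%type, (fun k p => B k.1 p.1 * B' k.2 p.2); split.
  move=> [i i'] [j j'] /=; rewrite KE KE' big_distrlr /= pair_bigA /=.
  by apply: eq_bigr => k _; rewrite mulrACA.
move=> v v0 [i i'].
apply: (Binj (fun i => v (i, i'))) => k.
apply: (Binj' (fun i' => \sum_i B k i * v (i, i'))) => k'.
transitivity (\sum_i \sum_i' B k i * B' k' i' * v (i, i')).
  rewrite exchange_big; apply: eq_bigr => j' _ /=; rewrite mulr_sumr.
  by apply: eq_bigr => j _; rewrite mulrCA mulrA.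
by rewrite -[RHS](v0 (k, k')) pair_bigA /=; apply: eq_bigr => -[].
Qed.

Lemma posdef_gram n (A : 'M[R]_n) : A^T = A ->
  (forall v : 'rV_n, v != 0 -> 0 < inner A v v) ->
  [/\ A \in unitmx, gram A & gram (invmx A)].
Proof.
move=> symA posA; have [L uL ->] := cholesky symA posA.
have uLT : L^T \in unitmx by rewrite unitmx_tr.
split.
- by rewrite unitmx_mul uL.
- exists 'I_n, (fun k a => L a k); split=> [a b|v v0 i].
    by rewrite mxE; apply: eq_bigr => k _; rewrite mxE.
  have : (\row_a v a) *m L = 0.
    apply/rowP => k; rewrite mxE [RHS]mxE -[RHS](v0 k).
    by apply: eq_bigr => a _; rewrite mxE mulrC.
  move=> /(congr1 (mulmx^~ (invmx L))) /=; rewrite mulmxK// mul0mx.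
  by move=> /rowP/(_ i); rewrite !mxE.
- exists 'I_n, (fun k a => invmx L k a); split=> [a b|v v0 i].
    have -> : invmx (L *m L^T) = (invmx L)^T *m invmx L.
      have uA : L *m L^T \in unitmx by rewrite unitmx_mul uL.
      apply: (can_inj (mulKmx uA)); rewrite mulmxV// mulmxA -(mulmxA L) -trmx_mul.
      by rewrite mulVmx// trmx1 mulmx1 mulmxV.
    by rewrite mxE; apply: eq_bigr => k _; rewrite mxE.
  have : invmx L *m (\col_a v a) = 0.
    apply/colP => k; rewrite mxE [RHS]mxE -[RHS](v0 k).
    by apply: eq_bigr => a _; rewrite mxE.
  move=> /(congr1 (mulmx L)) /=; rewrite mulKVmx// mulmx0.
  by move=> /colP/(_ i); rewrite !mxE.
Qed.

End Gram.

(** * Homothetic metrics and parabolic rescaling *)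

Section Scaling.
Context {R : realType} {m : nat} {M : manifold R m}.
Implicit Types (G : field M) (i : ix M) (u : 'rV[R]_m) (c : R).

Definition scale_field c G : field M := fun i u => c *: G i u.

Lemma metric_unit G i u : riemannian_metric G -> ccod (atlas i) u ->
  G i u \in unitmx.
Proof.
by move=> [_ sym pos _] iu; have [] := posdef_gram (sym _ _ iu) (pos _ _ iu).
Qed.

Lemma metric_derivable G i (a b : 'I_m) u v : riemannian_metric G ->
  ccod (atlas i) u -> derivable (fun w => G i w a b : R^o) u v.
Proof. by move=> [/(_ i a b)/(_ 1%N)[_ /(_ v)[+ _]]] => + _ _ _; exact. Qed.

Lemma inner_scale c (A : 'M[R]_m) v w : inner (c *: A) v w = c * inner A v w.
Proof. by rewrite /inner -scalemxAr -scalemxAl mxE. Qed.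

Lemma riemannian_metric_scale c G : 0 < c ->
  riemannian_metric G -> riemannian_metric (scale_field c G).
Proof.
move=> c0 [sm sym pos tr]; split.
- move=> i a b k.
  apply: (@class_C_affine R _ _ _ id id c _ _ _ k (fun u => G i u a b : R^o)) => //.
  + by move=> x; exact: cvg_id.
  + exact: ccod_open.
  + by move=> p _; rewrite /scale_field mxE.
  + exact: sm.
- by move=> i u iu; rewrite /scale_field linearZ /= sym.
- by move=> i u iu v v0; rewrite inner_scale mulr_gt0// pos.
- move=> i j u iju /=; rewrite /scale_field (tr _ _ _ iju) /=.
  by rewrite -scalemxAr -scalemxAl.
Qed.

Lemma partial_scale_metric c G i (a b d : 'I_m) u : riemannian_metric G ->
  ccod (atlas i) u ->
  partial a (fun w => scale_field c G i w b d) u = c * partial a (fun w => G i w b d) u.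
Proof.
move=> mG iu; rewrite /partial.
have -> : (fun w => scale_field c G i w b d : R^o) = c \*: (fun w => G i w b d : R^o).
  by apply/funext => w; rewrite /scale_field mxE.
by rewrite deriveZ//; exact: metric_derivable.
Qed.

(** The factor c of the derivatives of the metric cancels against the inverse
    metric. *)
Lemma christoffel_scale c G i (a b d : 'I_m) u : 0 < c -> riemannian_metric G ->
  ccod (atlas i) u ->
  christoffel (scale_field c G) i a b d u = christoffel G i a b d u.
Proof.
move=> c0 mG iu; rewrite /christoffel; congr (_ * _); apply: eq_bigr => e _.
have unitG := metric_unit mG iu.
rewrite /scale_field invmxZ ?unitmxZ ?unitfE ?gt_eqF//.
rewrite -/(scale_field c G) !partial_scale_metric// mxE.
rewrite -mulrDr -mulrBr mulrACA mulVf ?gt_eqF// mul1r//.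
Qed.

Lemma riemann_scale c G i (a b d e : 'I_m) u : 0 < c -> riemannian_metric G ->
  ccod (atlas i) u ->
  riemann (scale_field c G) i a b d e u = riemann G i a b d e u.
Proof.
move=> c0 mG iu; rewrite /riemann.
have dchr p x y z : partial p (christoffel (scale_field c G) i x y z) u
    = partial p (christoffel G i x y z) u.
  apply: near_eq_derive; have : nbhs u (ccod (atlas i)).
    by apply: open_nbhs_nbhs; split=> //; exact: ccod_open.
  by apply: filterS => w iw; exact: christoffel_scale.
rewrite !dchr; congr (_ + _); apply: eq_bigr => f _.
by rewrite !christoffel_scale.
Qed.

Lemma ricci_scale c G i u : 0 < c -> riemannian_metric G ->
  ccod (atlas i) u -> ricci (scale_field c G) i u = ricci G i u.
Proof.
move=> c0 mG iu; apply/matrixP => a b; rewrite !mxE.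
by apply: eq_bigr => d _; rewrite riemann_scale.
Qed.

Lemma sqrtrMl_sqr c (x : R) : 0 <= c -> Num.sqrt (c ^+ 2 * x) = c * Num.sqrt x.
Proof. by move=> c0; rewrite sqrtrM ?sqr_ge0// sqrtr_sqr ger0_norm. Qed.

Lemma ricci_norm_scale c G i u : 0 < c -> riemannian_metric G ->
  ccod (atlas i) u -> ricci_norm (scale_field c G) i u = c^-1 * ricci_norm G i u.
Proof.
move=> c0 mG iu; rewrite /ricci_norm ricci_scale//.
have unitG := metric_unit mG iu.
have c1 : 0 <= c^-1 by rewrite invr_ge0 ltW.
rewrite /scale_field invmxZ ?unitmxZ ?unitfE ?gt_eqF// -(sqrtrMl_sqr _ c1).
congr Num.sqrt.
do 4 (rewrite mulr_sumr; apply: eq_bigr => ? _).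
have zE a b : (c^-1 *: invmx (G i u)) a b = c^-1 * invmx (G i u) a b by rewrite mxE.
by rewrite !zE; ring.
Qed.

(** Three inverse metrics and one metric contract the (1,3)-curvature with
    itself, so the squared norm scales by c^-3 c = c^-2. *)
Lemma riemann_norm_scale c G i u : 0 < c -> riemannian_metric G ->
  ccod (atlas i) u -> riemann_norm (scale_field c G) i u = c^-1 * riemann_norm G i u.
Proof.
move=> c0 mG iu; rewrite /riemann_norm.
have unitG := metric_unit mG iu.
have c1 : 0 <= c^-1 by rewrite invr_ge0 ltW.
rewrite /scale_field invmxZ ?unitmxZ ?unitfE ?gt_eqF// -(sqrtrMl_sqr _ c1).
congr Num.sqrt.
do 8 (rewrite mulr_sumr; apply: eq_bigr => ? _).
rewrite -/(scale_field c G) !riemann_scale// !mxE.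
by field; rewrite gt_eqF.
Qed.

Lemma sup_ricci_scale c G : 0 < c -> riemannian_metric G ->
  sup_ricci (scale_field c G) = (c^-1%:E * sup_ricci G)%E.
Proof.
move=> c0 mG; rewrite /sup_ricci -ereal_sup_pZl ?invr_gt0//; congr ereal_sup.
apply/seteqP; split=> [_ [i [u [iu ->]]]|_ [_ [i [u [iu ->]]] <-]].
  by exists (ricci_norm G i u)%:E; [exists i, u | rewrite ricci_norm_scale].
by exists i, u; rewrite ricci_norm_scale.
Qed.

Lemma sup_riemann_scale c G : 0 < c -> riemannian_metric G ->
  sup_riemann (scale_field c G) = (c^-1%:E * sup_riemann G)%E.
Proof.
move=> c0 mG; rewrite /sup_riemann -ereal_sup_pZl ?invr_gt0//; congr ereal_sup.
apply/seteqP; split=> [_ [i [u [iu ->]]]|_ [_ [i [u [iu ->]]] <-]].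
  by exists (riemann_norm G i u)%:E; [exists i, u | rewrite riemann_norm_scale].
by exists i, u; rewrite riemann_norm_scale.
Qed.

(** The speed is multiplied by the square root of c, and the length is a lower
    integral of the speed. *)
Lemma curve_length_scale c G i gamma : 0 < c ->
  curve_length (scale_field c G) i gamma = Num.sqrt c * curve_length G i gamma.
Proof.
move=> c0; have sc0 : 0 < Num.sqrt c by rewrite sqrtr_gt0.
have fineZ (k : R) (x : \bar R) : 0 < k -> k * fine x = fine (k%:E * x)%E.
  move=> k0; case: x => [r| |] //=; rewrite mulr0.
    by rewrite gt0_muley ?lte_fin.
  by rewrite gt0_muleNy ?lte_fin.
rewrite /curve_length /Rintegral fineZ// -ge0_lower_integralZl//.
congr (fine _); apply: eq_integral => s _.
by rewrite -EFinM -sqrtrM ?ltW// inner_scale.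
Qed.

Lemma joined_scale c G x y L : 0 < c -> joined G x y L ->
  joined (scale_field c G) x y (Num.sqrt c * L).
Proof.
move=> c0; elim=> [{}x|i gamma {}y {}L cg _ IH].
  by rewrite mulr0; exact: joined_refl.
by rewrite mulrDr -(curve_length_scale G i gamma c0); exact: joined_step.
Qed.

Lemma riem_dist_scale_lt c G x y e : 0 < c -> (riem_dist G x y < e%:E)%E ->
  (riem_dist (scale_field c G) x y < (Num.sqrt c * e)%:E)%E.
Proof.
move=> c0 /ereal_inf_lt[_ [L /= xyL <-]]; rewrite lte_fin => Le.
apply: (@le_lt_trans _ _ (Num.sqrt c * L)%:E).
  by apply: ereal_inf_lbound; exists (Num.sqrt c * L) => //; exact: joined_scale.
by rewrite lte_fin ltr_pM2l// sqrtr_gt0.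
Qed.

Lemma scale_fieldVK c G : c != 0 -> scale_field c^-1 (scale_field c G) = G.
Proof.
move=> c0; apply/funext => i; apply/funext => u.
by rewrite /scale_field scalerA mulVf// scale1r.
Qed.

(** Scaling by c and by c^-1 shows that the two metrics have the same Cauchy
    sequences and the same limits. *)
Lemma complete_metric_scale c G : 0 < c ->
  complete_metric G -> complete_metric (scale_field c G).
Proof.
move=> c0 cG s sC; have sc0 : 0 < Num.sqrt c by rewrite sqrtr_gt0.
have [|x sx] := cG s.
  move=> e e0; have [|N sN] := sC (Num.sqrt c * e); first by rewrite mulr_gt0.
  exists N => k l Nk Nl.
  have /(@riem_dist_scale_lt c^-1) := sN k l Nk Nl.
  rewrite scale_fieldVK ?gt_eqF// invr_gt0 => /(_ c0).
  by rewrite sqrtrV ?ltW// mulrA mulVf ?gt_eqF// mul1r.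
exists x => e e0; have [|N sN] := sx ((Num.sqrt c)^-1 * e).
  by rewrite mulr_gt0// invr_gt0.
exists N => k Nk; have := riem_dist_scale_lt c0 (sN k Nk).
by rewrite mulrA divff ?gt_eqF// mul1r.
Qed.

Definition rescale_flow (q s : R) (g : R -> field M) : R -> field M :=
  fun tau => scale_field q (g (s + tau / q)).

(** Parabolic rescaling: the speed of time 1/q cancels the factor q of the
    metric, and the Ricci tensor of q g is that of g. *)
Lemma ricci_flow_rescale (I I' : set R) (q s : R) (g : R -> field M) :
  0 < q -> (forall tau, I' tau -> I (s + tau / q)) ->
  ricci_flow I g -> ricci_flow I' (rescale_flow q s g).
Proof.
move=> q0 I'I [met sm eqn]; split.
- move=> t /I'I/met[mg cg]; split; first exact: riemannian_metric_scale.
  exact: complete_metric_scale.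
- move=> i a b [t u] [/= I't iu].
  have [U [h [oU Up hsm hE]]] := sm i a b (s + t / q, u) (conj (I'I _ I't) iu).
  pose phi (p : R^o * 'rV[R]_m) : R^o * 'rV[R]_m := (s + p.1 / q, p.2).
  pose L (p : R^o * 'rV[R]_m) : R^o * 'rV[R]_m := (p.1 / q, p.2).
  have phi_cont : continuous phi.
    move=> p.
    have c1 : (fun x : R^o * 'rV[R]_m => s + x.1 / q : R^o) x @[x --> p] --> s + p.1 / q.
      by apply: cvgD; [exact: cvg_cst | apply: cvgMl; exact: cvg_fst].
    have c2 : (fun x : R^o * 'rV[R]_m => x.2) x @[x --> p] --> p.2 by exact: cvg_snd.
    exact: cvg_pair c1 c2.
  exists (phi @^-1` U), (fun p => q *: (h (phi p) : R^o)); split=> //.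
  + by move/continuousP: phi_cont; exact.
  + move=> k; apply: (@class_C_affine R _ _ _ phi L q _ _ U k h) => //.
    move=> p x v; rewrite /phi /L; apply: (congr1 (fun y : R => (y, (x *: v + p).2))).
    have /= e : s + (x * v.1 + p.1) / q = x * (v.1 / q) + (s + p.1 / q) :> R by ring.
    exact: e.
  + move=> p Up' [I'p ip]; rewrite /rescale_flow /scale_field mxE.
    by rewrite (hE (phi p))//; split=> //; exact: I'I.
- move=> t i u I't iu.
  have mg := (met _ (I'I _ I't)).1.
  rewrite /rescale_flow ricci_scale//.
  pose phi (x : R) := s + x / q.
  have := eqn _ i u (I'I _ I't) iu.
  pose H (x : R) := (x - phi t)^-1 *: (g x i u - g (phi t) i u).
  rewrite -/(phi t) -[X in X @ _ --> _]/H => cH.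
  rewrite (_ : (fun x => _) = H \o phi); last first.
    apply/funext => x; rewrite /H /= /scale_field -scalerBr scalerA; congr (_ *: _).
    rewrite (_ : phi x - phi t = (x - t) / q); last by rewrite /phi; ring.
    by rewrite invfM invrK mulrC.
  apply: cvg_comp cH => A nA.
  have phi_cont : s + x / q @[x --> t] --> s + t / q.
    by apply: cvgD; [exact: cvg_cst | apply: cvgMl; exact: cvg_id].
  have B : \forall x \near t, (s + x / q != phi t -> I (s + x / q) -> A (s + x / q)).
    exact: phi_cont _ nA.
  change (\forall x \near t, x != t -> I' x -> A (s + x / q)).
  apply: filterS B => x /= Ax xt I'x; apply: Ax; last exact: I'I.
  apply: contra_neq xt => /addrI/(congr1 ( *%R^~ q)).
  by rewrite !divfK ?gt_eqF.
Qed.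

End Scaling.

(** * Positivity of the curvature norms *)

Section Positivity.
Context {R : realType} {m : nat} {M : manifold R m}.
Implicit Types (G : field M) (i : ix M) (u : 'rV[R]_m).

Lemma sum4E (I : finType) (F : I -> I -> I -> I -> R) :
  \sum_a \sum_b \sum_c \sum_d F a b c d =
  \sum_(p : I * (I * (I * I))) F p.1 p.2.1 p.2.2.1 p.2.2.2.
Proof.
rewrite -(pair_bigA _ (fun a p => F a p.1 p.2.1 p.2.2)) /=; apply: eq_bigr => a _.
rewrite -(pair_bigA _ (fun b p => F a b p.1 p.2)) /=; apply: eq_bigr => b _.
by rewrite pair_bigA.
Qed.

(** The squared norm is the value at the curvature of a tensor product of four
    Gram kernels. *)
Lemma riemann_norm_gt0 G i u (a b c d : 'I_m) : riemannian_metric G ->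
  ccod (atlas i) u -> riemann G i a b c d u != 0 -> 0 < riemann_norm G i u.
Proof.
move=> [_ sym pos _] iu R0; have [_ gG gV] := posdef_gram (sym _ _ iu) (pos _ _ iu).
have gK := gram_tensor gV (gram_tensor gV (gram_tensor gV gG)).
have /lt_le_trans := gram_gt0 (v := fun p => riemann G i p.1 p.2.1 p.2.2.1 p.2.2.2 u) (i0 := (a, (b, (c, d)))) gK R0.
rewrite /riemann_norm sqrtr_gt0 sum4E; apply; apply: ler_sum => p _.
by rewrite sum4E; apply: ler_sum => q _; rewrite !mulrA.
Qed.

Lemma sup_riemann_gt0 G : riemannian_metric G -> ~ flat G -> (0 < sup_riemann G)%E.
Proof.
move=> mG nflat; apply: contrapT => /negP; rewrite -leNgt => Q0; apply: nflat.
move=> i u iu a b c d; apply/eqP/negPn/negP => R0.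
have := riemann_norm_gt0 mG iu R0; rewrite ltNge => /negP; apply.
rewrite -lee_fin; apply: le_trans Q0.
by apply: ereal_sup_ubound; exists i, u.
Qed.

Lemma not_flat_point G : ~ flat G -> exists i u, ccod (atlas i) u.
Proof.
move=> nflat; apply: contrapT => h; apply: nflat => i u iu.
by exfalso; apply: h; exists i, u.
Qed.

Lemma sup_ricci_ge0 G i u : ccod (atlas i) u -> (0 <= sup_ricci G)%E.
Proof.
move=> iu; apply: (@le_trans _ _ (ricci_norm G i u)%:E).
  by rewrite lee_fin sqrtr_ge0.
by apply: ereal_sup_ubound; exists i, u.
Qed.

Lemma sup_riemann_ge0 G i u : ccod (atlas i) u -> (0 <= sup_riemann G)%E.
Proof.
move=> iu; apply: (@le_trans _ _ (riemann_norm G i u)%:E).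
  by rewrite lee_fin sqrtr_ge0.
by apply: ereal_sup_ubound; exists i, u.
Qed.

End Positivity.

(** * Curvature growth and decay *)

Section Growth.
Context {R : realType}.

(** The primitive is x |-> - A ln (b - x). *)
Lemma integral_hyperbola (A b K : R) : 0 < K -> K < b ->
  (\int[lebesgue_measure]_(x in `[0%R, K]) (A / (b - x))%:E =
   (A * ln (b / (b - K)))%:E)%E.
Proof.
move=> K0 Kb.
pose F (x : R) : R := - A * ln (b - x).
have dF x : x < b -> is_derive x (1:R) F (A / (b - x)).
  move=> xb; have bx0 : 0 < b - x by rewrite subr_gt0.
  have Db : is_derive x (1 : R) (fun y : R => b - y) (-1).
    by apply: is_derive_eq; rewrite add0r mul1r.
  have Dln := is_derive1_ln bx0.
  have D := @is_derive1_comp R (@ln R) (fun y => b - y) x (b - x)^-1 (-1) Dln Db.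
  rewrite (_ : A / (b - x) = (- A) *: (((b - x)^-1) * (-1) : R)); last first.
    by rewrite mulrN1 scalerN scaleNr opprK.
  exact: is_deriveZ.
have cF x : x < b -> {for x, continuous F}.
  by move=> /dF D; apply/differentiable_continuous/derivable1_diffP; case: D.
rewrite (@continuous_FTC2 _ _ F)//.
- rewrite -EFinB /F subr0 ln_div ?posrE ?subr_gt0//; last exact: lt_trans Kb.
  by congr EFin; ring.
- apply: continuous_in_subspaceT => x /set_mem /=; rewrite in_itv /= => /andP[_ xK].
  apply: cvgMr; apply: cvgV; first by rewrite subr_eq0 gt_eqF// (le_lt_trans xK).
  by apply: cvgB; [exact: cvg_cst | exact: cvg_id].
- split.
  + by move=> x; rewrite in_itv /= => /andP[_ xK]; have [] := dF x (lt_trans xK Kb).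
  + by apply: cvg_at_right_filter; apply: cF; exact: lt_trans Kb.
  + by apply: cvg_at_left_filter; exact: cF.
- move=> x; rewrite in_itv /= => /andP[_ xK].
  have := dF x (lt_trans xK Kb) => D; rewrite derive1E; exact: derive_val.
Qed.

(** The exponential bound in the property of eps, for the flow rescaled to have
    curvature 1 at time s.  With q := Q(s), the interval [s, t] becomes
    [0, q (t - s)], and A / |x| becomes the hyperbola A / (- q s - tau). *)
Lemma curvature_growth (m : nat) (X : manifold R m) (g : R -> field X) (eps : R)
    (s t q A B : R) :
  epsilon0_property m eps -> ricci_flow `]-oo, 0] g -> s < t -> t < 0 -> 0 < q ->
  curvQ g s = q%:E ->
  (forall x, x <= s -> (curvQ g x <= (2 * q)%:E)%E) ->
  (forall x, x <= t -> (curvQ g x <= B%:E)%E) ->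
  (forall x, s <= x <= t -> (0 <= curvP g x <= (A / - x)%:E)%E) ->
  (curvQ g t < (q * expR (ln 2 * (eps^-1 * (A * ln (s / t)) + 1)))%:E)%E.
Proof.
move=> [eps0 epsP] flow st t0 q0 Qs Q2 QB PA.
pose h := rescale_flow q s g; pose K := q * (t - s).
have K0 : 0 < K by rewrite mulr_gt0// subr_gt0.
have timeK x : x <= K -> s + x / q <= t.
  by move=> xK; rewrite -lerBrDl ler_pdivrMr// mulrC.
have metg x : x <= 0 -> riemannian_metric (g x).
  by move=> x0; have [/(_ x)[]] := flow; rewrite /= ?in_itv.
have Qh x : x <= K -> curvQ h x = (q^-1%:E * curvQ g (s + x / q))%E.
  move=> xK; apply: sup_riemann_scale => //; apply: metg.
  by apply: le_trans (timeK _ xK) _; exact: ltW.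
have Ph x : x <= K -> curvP h x = (q^-1%:E * curvP g (s + x / q))%E.
  move=> xK; apply: sup_ricci_scale => //; apply: metg.
  by apply: le_trans (timeK _ xK) _; exact: ltW.
have sKt : s + K / q = t by rewrite /K; field; rewrite gt_eqF.
have flowh : ricci_flow `[- 8^-1, K] h.
  apply: ricci_flow_rescale flow => // x /=; rewrite !in_itv /= => /andP[_ xK].
  by apply: le_trans (timeK _ xK) _; exact: ltW.
have Bh : exists C : R, forall x, - 8^-1 <= x <= K -> (curvQ h x <= C%:E)%E.
  exists (q^-1 * B) => x /andP[_ xK]; rewrite Qh// EFinM lee_pmul2l//.
    by apply: QB; exact: timeK.
  by rewrite lte_fin invr_gt0.
have h0 : curvQ h 0 = 1%E.
  by rewrite Qh ?ltW// mul0r addr0 Qs -EFinM mulVf ?gt_eqF.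
have h2 x : - 8^-1 <= x <= 0 -> (curvQ h x <= 2%:E)%E.
  move=> /andP[_ x0]; rewrite Qh; last by apply: le_trans x0 _; exact: ltW.
  rewrite (_ : 2%:E = (q^-1%:E * (2 * q)%:E)%E); last first.
    by rewrite -EFinM mulrCA mulVf ?gt_eqF// mulr1.
  rewrite lee_pmul2l ?lte_fin ?invr_gt0//; apply: Q2.
  by rewrite gerDl pmulr_lle0// invr_gt0.
have [_] := epsP X h K (ltW K0) flowh Bh h0 h2.
rewrite Qh// sKt => hK.
have intP : (\int[lebesgue_measure]_(x in `[0%R, K]) curvP h x <=
             (A * ln (s / t))%:E)%E.
  have -> : s / t = (- (q * s)) / (- (q * s) - K).
    rewrite (_ : - (q * s) - K = - (q * t)); last by rewrite /K; ring.
    by field; rewrite lt_eqF// gt_eqF.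
  rewrite -integral_hyperbola//; last by rewrite /K; nra.
  have PAx x : `[0%R, K]%classic x ->
      (0 <= curvP h x <= (A / (- (q * s) - x))%:E)%E.
    rewrite /= in_itv /= => /andP[x0 xK].
    have /andP[P0 PA'] : (0 <= curvP g (s + x / q) <= (A / - (s + x / q))%:E)%E.
      by apply: PA; rewrite timeK// lerDl divr_ge0// ltW.
    rewrite Ph// mule_ge0 ?lee_fin ?invr_ge0 ?(ltW q0)//=.
    have -> : A / (- (q * s) - x) = q^-1 * (A / - (s + x / q)).
      have := timeK _ xK => sxt.
      rewrite (_ : - (q * s) - x = q * - (s + x / q)).
        by rewrite invfM mulrCA.
      by field; rewrite gt_eqF.
    by rewrite EFinM lee_pmul2l// lte_fin invr_gt0.
  by apply: ge0_le_lower_integral => x /PAx/andP[].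
rewrite -(@lte_pmul2l _ q^-1%:E)// ?lte_fin ?invr_gt0//.
apply: lt_le_trans hK _.
rewrite -EFinM mulKf ?gt_eqF// -[leRHS]/(expeR (_)%:E) lee_expeR.
rewrite (EFinM (ln 2)) lee_pmul2l// ?lte_fin ?ln_gt0 ?ltr1n//.
by rewrite EFinD leeD2r// EFinM lee_pmul2l// lte_fin invr_gt0.
Qed.

Lemma limf_esup_ninfty_lt (f : R -> \bar R) (l : \bar R) :
  (limf_esup f -oo%R < l)%E ->
  exists e N, (e < l)%E /\ forall t : R, t < N -> (f t <= e)%E.
Proof.
move=> /ereal_inf_lt[_ [V [N [_ NV]] <-] Vl].
exists (ereal_sup (f @` V)), N; split=> // t tN.
by apply: ereal_sup_ubound; exists t => //; exact: NV.
Qed.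

End Growth.

(** Times s at which f exceeds half of its supremum on a ray, for f bounded and
    positive at s0; they serve as base points for rescaling. *)
Lemma exists_half_sup {R : realType} (f : R -> \bar R) (s0 : R) (B : R) :
  (0 < f s0)%E -> (forall x, x <= s0 -> (0 <= f x <= B%:E)%E) ->
  exists s q, [/\ s <= s0, 0 < q, f s = q%:E &
    forall x, x <= s0 -> (f x <= (2 * q)%:E)%E].
Proof.
move=> fs0 fB; pose S := ereal_sup (f @` [set x | x <= s0]).
have S0 : (0 < S)%E.
  by apply: lt_le_trans fs0 _; apply: ereal_sup_ubound; exists s0 => /=.
have SB : (S <= B%:E)%E by apply: ge_ereal_sup => _ [x /= /fB/andP[_ ?] <-].
have SE : S = (fine S)%:E.
  by rewrite fineK// ge0_fin_numE ?(le_lt_trans SB) ?ltry// ltW.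
have r0 : 0 < fine S by rewrite -lte_fin -SE.
have : ((fine S / 2)%:E < S)%E by rewrite {2}SE lte_fin; lra.
move=> /ereal_sup_gt[_ [s /= ss0 <-]] fs.
have /andP[fs0' fsB] := fB _ ss0.
have fE : f s = (fine (f s))%:E.
  by rewrite fineK// ge0_fin_numE// (le_lt_trans fsB) ?ltry.
move: fs; rewrite fE lte_fin => fs.
exists s, (fine (f s)); split=> //; first lra.
move=> x xs; apply: (@le_trans _ _ S).
  by apply: ereal_sup_ubound; exists x.
by rewrite SE lee_fin; lra.
Qed.

Theorem corollary1 (R : realType) (m : nat) (eps0 : R)
    (eps0P : epsilon0_property m eps0)
    (X : manifold R m) (g : R -> field X)
    (flow_g : ricci_flow `]-oo, 0] g)
    (non_flat_g : non_flat_ancient g)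
    (typeI_g :
      (limf_esup (fun t : R => curvQ g t * `|t|%:E) -oo%R < +oo)%E) :
  ((eps0 / ln 2)%:E <= limf_esup (fun t : R => curvP g t * `|t|%:E) -oo%R)%E.
Proof.
have eps_gt0 := eps0P.1.
have ln2_gt0 : 0 < ln (2 : R) by rewrite ln_gt0// ltr1n.
rewrite leNgt; apply/negP => limP.
have metg x : x <= 0 -> riemannian_metric (g x).
  by move=> x0; have [/(_ x)[]] := flow_g; rewrite /= ?in_itv.
have [i [u iu]] : exists i u, ccod (atlas (i : ix X)) u.
  by have [s _ /not_flat_point] := non_flat_g 0 (lexx _).
have Q_gt0 N : exists s, [/\ s < N, s < 0 & (0 < curvQ g s)%E].
  have N0 : Num.min (N - 1) (- 1) <= 0 by rewrite ge_min lerN10 orbT.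
  have [s] := non_flat_g _ N0; rewrite le_min => /andP[sN s1] nf.
  have s0 : s < 0 by lra.
  exists s; split=> //; first by lra.
  by apply: sup_riemann_gt0 nf; apply: metg; exact: ltW.
have Q_ge0 x : (0 <= curvQ g x)%E by exact: sup_riemann_ge0 iu.
have P_ge0 x : (0 <= curvP g x)%E by exact: sup_ricci_ge0 iu.
have normE (x : R) : x < 0 -> `|x| = - x by move=> x0; rewrite ltr0_norm.
have bound (f : R -> \bar R) l : (forall x, 0 <= f x)%E ->
    (limf_esup (fun t : R => f t * `|t|%:E) -oo%R < l)%E ->
    exists A N, (A%:E < l)%E /\ forall x, x < N -> x < 0 -> (f x <= (A / - x)%:E)%E.
  move=> f0 /limf_esup_ninfty_lt[e [N [el fN]]].
  have e0 : (0 <= e)%E.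
    by apply: le_trans (fN (N - 1) _); [rewrite mule_ge0// lee_fin | lra].
  have eE : e = (fine e)%:E by rewrite fineK// ge0_fin_numE// (lt_le_trans el) ?leey.
  exists (fine e), N; rewrite -eE; split=> // x xN x0.
  have := fN x xN; rewrite normE// eE => h.
  by rewrite EFinM lee_pdivlMr// oppr_gt0.
have [C [N1 [_ QC]]] := bound _ _ Q_ge0 typeI_g.
have [A [N2 [Aeps PA]]] := bound _ _ P_ge0 limP.
move: Aeps; rewrite lte_fin ltr_pdivlMr// => Aeps.
pose a := A * ln 2 / eps0.
have a1 : a < 1 by rewrite ltr_pdivrMr// mul1r.
have [t [tN t0 Qt]] := Q_gt0 (Num.min N1 N2).
move: tN; rewrite lt_min => /andP[tN1 tN2].
have C0 : 0 < C.
  have := lt_le_trans Qt (QC t tN1 t0).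
  by rewrite lte_fin pmulr_lgt0// invr_gt0 oppr_gt0.
pose B := C / - t.
have QB x : x <= t -> (curvQ g x <= B%:E)%E.
  move=> xt; apply: (le_trans (QC x _ _)); [lra|lra|].
  by rewrite lee_fin ler_pM2l// lef_pV2 ?posrE; lra.
pose y := fine (curvQ g t).
have yE : curvQ g t = y%:E.
  by rewrite /y fineK// ge0_fin_numE// (le_lt_trans (QB _ (lexx _))) ?ltry.
have y0 : 0 < y by rewrite -lte_fin -yE.
(* Z solves 2 B expR ((a - 1) Z) = y: once ln (s / t) exceeds Z, the growth
   bound falls below y = Q(t). *)
pose Z := ln (2 * B / y) / (1 - a).
have [s0 [s0N s00 Qs0]] := Q_gt0 (Num.min t (t * expR Z)).
move: s0N; rewrite lt_min => /andP[s0t s0Z].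
have [|s [q [ss0 q0 Qs Qle]]] := exists_half_sup (B := B) Qs0.
  by move=> x xs; rewrite Q_ge0 QB//; lra.
have st : s < t by lra.
have := curvature_growth (A := A) eps0P flow_g st t0 q0 Qs _ QB _.
rewrite yE lte_fin => growth.
have {growth} : y < q * expR (ln 2 * (eps0^-1 * (A * ln (s / t)) + 1)).
  apply: growth => x; first by move=> xs; apply: Qle; lra.
  by move=> /andP[sx xt]; rewrite P_ge0/= PA//; lra.
pose sigma := s / t.
have tsigma : s = t * sigma by rewrite /sigma mulrCA divff ?mulr1// lt_eqF.
have sigmaZ : expR Z < sigma by rewrite /sigma ltr_ndivlMr//; lra.
have sigma0 : 0 < sigma by apply: lt_trans sigmaZ; exact: expR_gt0.
(* As |s| = |t| sigma, this is the type I bound q <= C / |s|. *)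
have qB : q <= B / sigma.
  rewrite -lee_fin -Qs; apply: (le_trans (QC s _ _)); [lra|lra|].
  by rewrite lee_fin /B tsigma -mulNr invfM mulrA.
have -> : ln 2 * (eps0^-1 * (A * ln (s / t)) + 1) = a * ln sigma + ln 2.
  by rewrite /a -/sigma; field; rewrite gt_eqF.
rewrite expRD lnK ?posrE// => growth.
have B0 : 0 < 2 * B by rewrite mulr_gt0// divr_gt0// oppr_gt0.
suff yge : 2 * B * expR ((a - 1) * ln sigma) <= y.
  move: growth; rewrite ltNge => /negP; apply; apply: le_trans yge.
  rewrite mulrBl mul1r expRB lnK ?posrE//.
  have -> : 2 * B * (expR (a * ln sigma) / sigma) =
      B / sigma * (expR (a * ln sigma) * 2) by ring.
  by rewrite ler_pM2r// mulr_gt0// expR_gt0.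
rewrite -ler_pdivlMl// -[leRHS]lnK ?posrE; last by rewrite mulr_gt0 ?invr_gt0.
rewrite ler_expR -[y in leRHS]invrK -invfM lnV ?posrE ?divr_gt0//.
rewrite lerNr -mulNr opprB [leRHS]mulrC -ler_pdivrMr ?subr_gt0// -/Z; apply: ltW.
by rewrite -ltr_expR lnK.
Qed.
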